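(* Let $N\ge2$ be an integer, $v>0$ and $s\in\left[0,\sqrt{2N/(N-1)}\right]$. Consider currencies $0,1,\dots,N$ with $E[Q_{0i}]=q$ and $\sigma_{0i}^2=\sigma^2$ for all $i\ge1$, and $E[Q_{ij}]=vq$ and $\sigma_{ij}^2=s^2\sigma^2$ for all $i\ne j$ with $i,j\ge1$. For weights $w_0,\dots,w_N>0$ with $\sum_i w_i=1$ let the expected aggregate trading cost be $$c(w)=\sqrt{\Delta\,H_w\sum_{i=0}^N\frac{E[Q_i]}{w_i}},\qquad H_w=\sum_{0\le i<j\le N}w_iw_j\sigma_{ij}^2,\qquad E[Q_i]=\sum_{j\neq i}E[Q_{ij}].$$ If $s^2<\dfrac{2(1+Nv)}{1+(N-1)v}$, then the expected aggregate trading cost has a unique interior minimizer, at $w_i^*=\dfrac{1-w_0^*}{N}$ for all $i>0$ and $$w_0^*=\frac{s}{\sqrt{(1+Nv)\bigl(2N-(N-1)s^2\bigr)}}.$$ If $s^2\ge\dfrac{2(1+Nv)}{1+(N-1)v}$, no interior minimizer exists; the infimum over $w_1,\dots,w_N>0$ is obtained as $w_0\to1$.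
   Context: Currency $0$ is a vehicle currency (numeraire); $q,\sigma,\Delta>0$. $\sigma_{ij}^2$ is the variance of the difference of the gross returns of currencies $i$ and $j$, and $E[Q_{ij}]=E[Q_{ji}]$ is the expected trading volume of the pair $(i,j)$. The range of $s$ is forced by positive semidefiniteness of the covariance matrix of the returns of currencies $1,\dots,N$. The cost $c(w)$ is the fee-optimized equilibrium expected aggregate trading cost of a constant-mean AMM pool (invariant $\prod_i R_i^{w_i}=$ const in the reserves $R_i$) with weights $w$ and trade size $\Delta$. Since currencies $1,\dots,N$ are symmetric, the weights are taken to satisfy $w_i=(1-w_0)/N$ for $i\ge1$, so that the problem is an optimization over the scalar $w_0$.
   Formalization: The unique interior minimizer is claimed only for s>0: at s=0 the cost is strictly increasing in w_0 and the formula gives w_0*=0, which is not interior. For s=0 it is proved instead that no interior minimizer exists and the infimum is approached as w_0→0. *)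

(* Defs.v *)
(* Built on MathComp-Analysis: the reals are an arbitrary realType. *)
From HB Require Import structures.
From mathcomp Require Import all_boot all_order all_algebra.
From mathcomp Require Import all_classical all_reals all_analysis.

Set Implicit Arguments.
Unset Strict Implicit.
Unset Printing Implicit Defensive.

Import Order.TTheory GRing.Theory Num.Theory.
Import numFieldNormedType.Exports.

Local Open Scope classical_set_scope.
Local Open Scope ring_scope.

(* In this file the currencies are the elements of 'I_N.+1, and ord0 is the
   vehicle currency. [EQ i j] is E[Q_ij] and [var i j] is sigma_ij^2 (already
   squared); their diagonal entries are never used. *)

(* E[Q_i] *)
Definition volume (R : realType) (N : nat)
    (EQ : 'I_N.+1 -> 'I_N.+1 -> R) (i : 'I_N.+1) : R :=
  \sum_(j < N.+1 | j != i) EQ i j.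

(* H_w *)
Definition pool_variance (R : realType) (N : nat)
    (var : 'I_N.+1 -> 'I_N.+1 -> R) (w : 'rV[R]_N.+1) : R :=
  \sum_(i < N.+1) \sum_(j < N.+1 | (i < j)%N) w ord0 i * w ord0 j * var i j.

(* c(w) *)
Definition trading_cost (R : realType) (N : nat) (Delta : R)
    (EQ var : 'I_N.+1 -> 'I_N.+1 -> R) (w : 'rV[R]_N.+1) : R :=
  Num.sqrt (Delta * pool_variance var w *
            \sum_(i < N.+1) volume EQ i / w ord0 i).

Definition interior_weights (R : realType) (N : nat) : set 'rV[R]_N.+1 :=
  [set w | (forall i, 0 < w ord0 i) /\ \sum_(i < N.+1) w ord0 i = 1].

(* The non-vehicle currencies are interchangeable, so they share the remaining
   weight equally; this leaves w_0 as the only degree of freedom. *)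
Definition symmetric_weights (R : realType) (N : nat) : set 'rV[R]_N.+1 :=
  [set w | forall i, i != ord0 -> w ord0 i = (1 - w ord0 ord0) / N%:R].

Definition feasible_weights (R : realType) (N : nat) : set 'rV[R]_N.+1 :=
  @interior_weights R N `&` @symmetric_weights R N.

(* The symmetric weight vector with w_0 = x. *)
Definition weights_of (R : realType) (N : nat) (x : R) : 'rV[R]_N.+1 :=
  \row_(i < N.+1) (if i == ord0 then x else (1 - x) / N%:R).

Definition is_minimizer (R : realType) (T : Type) (A : set T) (f : T -> R)
    (a : T) : Prop :=
  A a /\ forall b, A b -> f a <= f b.

(* Main.v *)
(* At the symmetric weights with w_0 = x, the squared cost is a positive
   constant times g(x) = a / x + p x + const, where
   a = (N - 1) s^2 / (2 N) and p = (1 - a) (N - 1) (1 + N v), and the bound on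
   s says a <= 1. From g(x) - g(y) = (y - x) (a / (x y) - p) one reads off that
   g has its strict minimum at sqrt(a / p); this point is below 1 exactly when
   a < p, which is the threshold condition. If p <= a then g decreases on
   (0, 1], and if a = 0 then g increases, so the infimum is only approached at
   an endpoint. *)
Require Import Defs.
From HB Require Import structures.
From mathcomp Require Import all_boot all_order all_algebra.
From mathcomp Require Import all_classical all_reals all_analysis.
From mathcomp Require Import ring lra.

Set Implicit Arguments.
Unset Strict Implicit.
Unset Printing Implicit Defensive.

Import Order.TTheory GRing.Theory Num.Theory.
Import numFieldNormedType.Exports.

Local Open Scope classical_set_scope.
Local Open Scope ring_scope.

(** * Volumes and variance of the pool at symmetric weights *)

Lemma sum_ltn_const (R : comPzRingType) (n : nat) (c : R) :
  2 * (\sum_(i < n) \sum_(j < n | (i < j)%N) c) = n%:R * (n%:R - 1) * c.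
Proof.
(* Exchanging the indices shows that the pairs below and above the diagonal contribute equally;
   together they fill each row except its diagonal entry, leaving [n - 1] terms per row. *)
have swap : \sum_(i < n) \sum_(j < n | (i < j)%N) c
    = \sum_(i < n) \sum_(j < n | (j < i)%N) c.
  rewrite (exchange_big_dep predT) //=.
have row (i : 'I_n) : \sum_(j < n | (i < j)%N) c + \sum_(j < n | (j < i)%N) c
    = (n%:R - 1) * c.
  have -> : (n%:R - 1) * c = \sum_(j < n | j != i) c.
    have : \sum_(j < n) c = n%:R * c by rewrite sumr_const card_ord mulr_natl.
    rewrite (bigD1 i) //= => e; rewrite mulrBl mul1r -e; ring.
  rewrite (bigID (fun j : 'I_n => (i < j)%N) (fun j => j != i)) /=.
  congr (_ + _); apply: eq_bigl => j; rewrite -val_eqE /=; case: ltngtP => //.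
rewrite mulr_natl mulr2n {2}swap -big_split /=.
under eq_bigr => i _ do rewrite row.
by rewrite sumr_const card_ord -[LHS]mulr_natl; ring.
Qed.

Section SymmetricPool.
Variables (R : realType) (N : nat) (EQ var : 'I_N.+1 -> 'I_N.+1 -> R).
Hypothesis N_ge2 : (2 <= N)%N.

Lemma volume_vehicle (q : R) :
  (forall i, i != ord0 -> EQ ord0 i = q) -> volume EQ ord0 = N%:R * q.
Proof.
move=> EQ0; rewrite /volume (eq_bigr (fun=> q)) => [|i /EQ0//].
by rewrite sumr_const cardC1 card_ord mulr_natl.
Qed.

Lemma volume_other (q u : R) (i : 'I_N.+1) :
  (forall i j, EQ i j = EQ j i) ->
  (forall i, i != ord0 -> EQ ord0 i = q) ->
  (forall i j, i != ord0 -> j != ord0 -> i != j -> EQ i j = u) ->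
  i != ord0 -> volume EQ i = q + (N%:R - 1) * u.
Proof.
move=> EQC EQ0 EQn0 i0; rewrite /volume (bigD1 ord0) 1?eq_sym //=.
rewrite EQC EQ0 //; congr (_ + _).
rewrite (eq_bigr (fun=> u)); last first.
  by move=> j /andP[ji j0]; rewrite EQn0 // eq_sym.
(* The remaining sum omits both [i] and [ord0]; adding [u + u] restores the full sum of [N.+1] equal
   terms. *)
have : \sum_(j < N.+1) u = N.+1%:R * u by rewrite sumr_const card_ord mulr_natl.
rewrite (bigD1 i) //= (bigD1 ord0) 1?eq_sym //= -natr1 => e.
by apply: (addrI (u + u)); rewrite -addrA e; ring.
Qed.

(** There are [N] vehicle pairs of weight x(1-x)/N each, and N(N-1)/2 other pairs of weight
    ((1-x)/N)^2 each. *)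
Lemma pool_variance_weights_of (t u x : R) :
  (forall i, i != ord0 -> var ord0 i = t) ->
  (forall i j, i != ord0 -> j != ord0 -> i != j -> var i j = u) ->
  pool_variance var (weights_of N x)
  = (1 - x) * (t * x + (N%:R - 1) / (2 * N%:R) * u * (1 - x)).
Proof.
move=> var0 varn0; have N0 : N%:R != 0 :> R by rewrite pnatr_eq0; case: N N_ge2.
rewrite /pool_variance big_ord_recl /=.
under eq_bigr => j j0.
  have jn0 : j != ord0 by rewrite -val_eqE /= -lt0n.
  rewrite !mxE eqxx (negPf jn0) var0 //; over.
(* In the rows of the other currencies, column 0 fails [i < j]; the lift shifts both remaining
   indices by one, so the condition is again [i < j], now over ['I_N]. *)
under [X in _ + X]eq_bigr => i _.
  rewrite big_mkcond big_ord_recl /= add0r.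
  under eq_bigr => j _.
    rewrite !mxE /= /bump /= !add1n ltnS.
    over.
  rewrite -big_mkcond /=.
  under eq_bigr => j ij.
    rewrite varn0 //; last by rewrite -val_eqE /= /bump /= !add1n eqSS ltn_eqF.
    over.
  over.
set y := (1 - x) / N%:R.
rewrite big_mkcond big_ord_recl /= add0r sumr_const card_ord -mulr_natl.
have := sum_ltn_const N (y * y * u); set S := \sum_(i < N) _ => eS.
have -> : S = N%:R * (N%:R - 1) * (y * y * u) / 2 by rewrite -eS; field.
by rewrite /y; field.
Qed.

Lemma sum_volume_weights_of (q u x : R) :
  (forall i j, EQ i j = EQ j i) ->
  (forall i, i != ord0 -> EQ ord0 i = q) ->
  (forall i j, i != ord0 -> j != ord0 -> i != j -> EQ i j = u) ->
  \sum_(i < N.+1) volume EQ i / weights_of N x ord0 i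
  = N%:R * q / x + N%:R ^+ 2 * (q + (N%:R - 1) * u) / (1 - x).
Proof.
move=> EQC EQ0 EQn0; rewrite big_ord_recl (volume_vehicle EQ0) mxE eqxx.
congr (_ + _); under eq_bigr => i _ do
  rewrite (volume_other EQC EQ0 EQn0) // mxE /= invf_div.
by rewrite sumr_const card_ord -mulr_natl; ring.
Qed.

Lemma feasible_weights_of (x : R) :
  0 < x < 1 -> feasible_weights (R := R) (N := N) (weights_of N x).
Proof.
move=> /andP[x0 x1]; have N0 : 0 < N%:R :> R by rewrite ltr0n; case: N N_ge2.
split; last by move=> i i0; rewrite !mxE eqxx (negPf i0).
split=> [i|]; first by rewrite mxE; case: eqP => // _; rewrite divr_gt0 ?subr_gt0.
rewrite big_ord_recl mxE eqxx; under eq_bigr => i _ do rewrite mxE /=.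
by rewrite sumr_const card_ord -[X in _ + X]mulr_natl; field; rewrite gt_eqF.
Qed.

(** Reduces every question about feasible vectors to the scalar w_0. It lies below 1 because at
    least one other weight is positive. *)
Lemma feasible_weightsE (w : 'rV[R]_N.+1) : feasible_weights w ->
  0 < w ord0 ord0 < 1 /\ w = weights_of N (w ord0 ord0).
Proof.
move=> [[w_gt0 w_sum] w_sym]; split.
  rewrite w_gt0 /= -w_sum big_ord_recl ltrDl.
  have i1 : (0 < N)%N by case: N N_ge2.
  rewrite (bigD1 (Ordinal i1)) //= ltr_pwDl // sumr_ge0 // => i _.
  exact/ltW.
apply/rowP => i; rewrite mxE; case: eqP => [->//|/eqP]; exact: w_sym.
Qed.

End SymmetricPool.

(* Up to a constant factor this is the squared cost at [weights_of N x]; it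
   equals [(a + (1 - a) * x) * (1 + m * x) / x]. *)
Definition reduced_cost (R : realType) (a m x : R) : R :=
  a / x + (1 - a) * m * x + (1 - a + a * m).

(** * Sign, minimum and monotonicity of the one-variable cost *)

Section ReducedCost.
Variables (R : realType) (a m : R).

Lemma reduced_costB (x y : R) : x != 0 -> y != 0 ->
  reduced_cost a m x - reduced_cost a m y
  = (y - x) * (a / (x * y) - (1 - a) * m).
Proof. by move=> x0 y0; rewrite /reduced_cost; field; rewrite x0 y0. Qed.

(** Positivity lets strict comparisons pass through the square root. The factor a + (1-a)x is
    positive thanks to x if a = 0, and thanks to a otherwise. *)
Lemma reduced_cost_gt0 (x : R) : 0 <= a <= 1 -> 0 < m -> 0 < x ->
  0 < reduced_cost a m x.
Proof.
move=> /andP[a0 a1] m0 x0.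
have -> : reduced_cost a m x = (a + (1 - a) * x) * (1 + m * x) / x.
  by rewrite /reduced_cost; field; rewrite gt_eqF.
rewrite divr_gt0 // mulr_gt0 //; last by rewrite ltr_wpDr ?ltr01// ltW ?mulr_gt0.
have [->|an0] := eqVneq a 0; first by rewrite subr0 mul1r add0r.
by rewrite ltr_wpDr ?mulr_ge0 ?subr_ge0 ?(ltW x0)// lt_neqAle eq_sym an0.
Qed.

(** Substituting a = p r^2 turns the difference of costs into p (x-r)^2 / x. *)
Lemma reduced_cost_min (r x : R) : 0 < (1 - a) * m -> 0 < r ->
  r ^+ 2 = a / ((1 - a) * m) -> 0 < x -> x != r ->
  reduced_cost a m r < reduced_cost a m x.
Proof.
move=> p0 r0 r2 x0 xr; rewrite -subr_gt0 reduced_costB ?gt_eqF//.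
set p := (1 - a) * m in p0 r2 *.
have -> : a = p * r ^+ 2 by rewrite r2 mulrC divfK ?gt_eqF.
have -> : (r - x) * (p * r ^+ 2 / (x * r) - p) = p * (x - r) ^+ 2 / x.
  by field; rewrite !gt_eqF.
by rewrite divr_gt0// mulr_gt0// exprn_even_gt0//= subr_eq0.
Qed.

(** Here xy < 1, hence a/(xy) > a >= p. *)
Lemma reduced_cost_decreasing (x y : R) : 0 < a -> (1 - a) * m <= a ->
  0 < x -> x < y -> y <= 1 -> reduced_cost a m y < reduced_cost a m x.
Proof.
move=> a0 pa x0 xy y1; have y0 := lt_trans x0 xy.
rewrite -subr_gt0 reduced_costB ?gt_eqF// mulr_gt0 ?subr_gt0//.
apply: (le_lt_trans pa); rewrite ltr_pdivlMr ?mulr_gt0// gtr_pMr//.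
apply: (lt_le_trans _ y1); rewrite gtr_pMl//; exact: lt_le_trans xy y1.
Qed.

Lemma reduced_cost_continuous (x : R) : x != 0 ->
  {for x, continuous (reduced_cost a m)}.
Proof.
move=> x0; apply: cvgD; last exact: cvg_cst.
apply: cvgD; apply: cvgM; [exact: cvg_cst|exact: cvgV|exact: cvg_cst|exact: cvg_id].
Qed.

End ReducedCost.

(** As a limit of points of [A], [l] is at least [inf A]; as a lower bound it is at most that.
    Properness of [F] makes [A] nonempty, so [inf A] is not a default value. *)
Lemma cvg_inf (R : realType) (T : Type) (F : set_system T) (A : set R)
    (u : T -> R) (l : R) : ProperFilter F ->
  lbound A l -> (\forall t \near F, A (u t)) -> u @ F --> l ->
  u @ F --> inf A.
Proof.
move=> FF lA uA ul; suff -> : inf A = l by [].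
have hA : has_inf A.
  by split; [have [t ?] := filter_ex uA; exists (u t)|exists l].
apply/eqP; rewrite eq_le; apply/andP; split; last first.
  by apply: lb_le_inf => //; exact: hA.1.
apply: (cvgr_to_ge ul); apply: filterS uA => t; apply: ge_inf; exact: hA.2.
Qed.

(** The variance is proportional to (1-x)(a + (1-a)x) and the volume sum to (1 + mx)/(x(1-x)), with
    m = N(1+(N-1)v) - 1 = (N-1)(1+Nv). The factors 1-x cancel, so nothing blows up at x = 1. *)
Lemma trading_cost_weights_of (R : realType) (N : nat) (q sigma Delta v s x : R)
    (EQ var : 'I_N.+1 -> 'I_N.+1 -> R) :
  (2 <= N)%N ->
  (forall i j, EQ i j = EQ j i) ->
  (forall i, i != ord0 -> EQ ord0 i = q) ->
  (forall i j, i != ord0 -> j != ord0 -> i != j -> EQ i j = v * q) ->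
  (forall i, i != ord0 -> var ord0 i = sigma ^+ 2) ->
  (forall i j, i != ord0 -> j != ord0 -> i != j ->
     var i j = s ^+ 2 * sigma ^+ 2) ->
  0 < x < 1 ->
  trading_cost Delta EQ var (weights_of N x)
  = Num.sqrt (Delta * sigma ^+ 2 * N%:R * q *
      reduced_cost ((N%:R - 1) / (2 * N%:R) * s ^+ 2)
                   ((N%:R - 1) * (1 + N%:R * v)) x).
Proof.
move=> N2 EQC EQ0 EQn0 var0 varn0 /andP[x0 x1].
have N0 : N%:R != 0 :> R by rewrite gt_eqF// ltr0n ltnW.
rewrite /trading_cost (pool_variance_weights_of N2 _ var0 varn0).
rewrite (sum_volume_weights_of _ EQC EQ0 EQn0) /reduced_cost.
by congr Num.sqrt; field; rewrite N0 gt_eqF//= subr_eq0 gt_eqF.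
Qed.

(** * Transfer from the scalar problem to feasible weights *)

Section CostOfReducedCost.
Variables (R : realType) (N : nat) (c : 'rV[R]_N.+1 -> R) (K : R) (g : R -> R).
Hypotheses (N_ge2 : (2 <= N)%N) (K_gt0 : 0 < K).
Hypothesis g_gt0 : forall x, 0 < x -> 0 < g x.
Hypothesis cE : forall x, 0 < x < 1 -> c (weights_of N x) = Num.sqrt (K * g x).

Let W := feasible_weights (R := R) (N := N).

Lemma cost_lt (x y : R) : 0 < x < 1 -> 0 < y < 1 ->
  (c (weights_of N x) < c (weights_of N y)) = (g x < g y).
Proof.
move=> x01 y01; have /andP[y0 _] := y01.
by rewrite !cE// ltr_sqrt ?mulr_gt0 ?g_gt0// ltr_pM2l.
Qed.

Lemma unique_minimizer_weights_of (r : R) : 0 < r < 1 ->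
  (forall x, 0 < x -> x != r -> g r < g x) ->
  unique (is_minimizer W c) (weights_of N r).
Proof.
move=> r01 g_min; split; first split; first exact: feasible_weights_of.
  move=> w /(feasible_weightsE N_ge2) [w01 ->]; move: (w _ _) w01 => x x01.
  have [->//|xr] := eqVneq x r; have /andP[x0 _] := x01.
  by rewrite ltW // cost_lt // g_min.
move=> w [/(feasible_weightsE N_ge2) [w01 ->]]; move: (w _ _) w01 => x x01.
have [->//|xr] := eqVneq x r; have /andP[x0 _] := x01.
move=> /(_ _ (feasible_weights_of N_ge2 r01)).
by rewrite leNgt cost_lt // g_min.
Qed.

Lemma no_minimizer :
  (forall x, 0 < x < 1 -> exists2 y, 0 < y < 1 & g y < g x) ->
  ~ exists w, is_minimizer W c w.
Proof.
move=> g_lt [w [/(feasible_weightsE N_ge2) [w01 ->]]].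
have [y y01 gy] := g_lt _ w01 => /(_ _ (feasible_weights_of N_ge2 y01)).
by rewrite leNgt cost_lt // gy.
Qed.

(** The filter is left general so as to serve both endpoints, 1 from the left and 0 from the
    right. *)
Lemma cost_cvg_inf (F : set_system R) (l : R) : ProperFilter F ->
  (\forall x \near F, 0 < x < 1) -> g x @[x --> F] --> l ->
  (forall x, 0 < x < 1 -> l <= g x) ->
  c (weights_of N x) @[x --> F] --> inf [set c w | w in W].
Proof.
move=> FF F01 gl l_le; apply: (@cvg_inf _ _ _ _ _ (Num.sqrt (K * l))).
- move=> _ [w /(feasible_weightsE N_ge2) [w01 ->] <-]; rewrite cE//.
  by rewrite ler_wsqrtr// ler_pM2l// l_le.
- apply: filterS F01 => x x01; exists (weights_of N x) => //.
  exact: feasible_weights_of.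
(* The formula [cE] holds only on (0,1), where [F] eventually lives. *)
- apply: (@cvg_trans _ ((fun x => Num.sqrt (K * g x)) @ F)).
    by apply: near_eq_cvg; apply: filterS F01 => x /cE.
  apply: (@continuous_cvg _ R R _ _ (fun x => K * g x) (@Num.sqrt R) (K * l)).
    exact: sqrt_continuous.
  by apply: cvgM gl; exact: cvg_cst.
Qed.

End CostOfReducedCost.

(** At s = 0 the formula for w_0^* gives 0, which is not interior. Hence the first clause asks for
    [0 < s], and s = 0 has its own clause, with the infimum approached as w_0 tends to 0. *)
Theorem proposition7 (R : realType) (N : nat) (q sigma Delta v s : R)
    (EQ var : 'I_N.+1 -> 'I_N.+1 -> R)
    (hN : (2 <= N)%N)
    (hq : 0 < q) (hsigma : 0 < sigma) (hDelta : 0 < Delta) (hv : 0 < v)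
    (hs : 0 <= s <= Num.sqrt (2 * N%:R / (N%:R - 1)))
    (EQ_sym : forall i j, EQ i j = EQ j i)
    (EQ_vehicle : forall i, i != ord0 -> EQ ord0 i = q)
    (EQ_other : forall i j, i != ord0 -> j != ord0 -> i != j ->
       EQ i j = v * q)
    (var_sym : forall i j, var i j = var j i)
    (var_vehicle : forall i, i != ord0 -> var ord0 i = sigma ^+ 2)
    (var_other : forall i j, i != ord0 -> j != ord0 -> i != j ->
       var i j = s ^+ 2 * sigma ^+ 2) :
  let c := trading_cost Delta EQ var in
  let W := @feasible_weights R N in
  let threshold := 2 * (1 + N%:R * v) / (1 + (N%:R - 1) * v) in
  [/\ (0 < s -> s ^+ 2 < threshold ->
        exists wstar : 'rV[R]_N.+1,
          [/\ unique (is_minimizer W c) wstar,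
              wstar ord0 ord0 =
                s / Num.sqrt ((1 + N%:R * v) *
                              (2 * N%:R - (N%:R - 1) * s ^+ 2)) &
              forall i, i != ord0 ->
                wstar ord0 i = (1 - wstar ord0 ord0) / N%:R]),
      (threshold <= s ^+ 2 ->
        (~ exists w, is_minimizer W c w) /\
        c (weights_of N x) @[x --> 1^'-] --> inf [set c w | w in W]) &
      (s = 0 ->
        (~ exists w, is_minimizer W c w) /\
        c (weights_of N x) @[x --> 0^'+] --> inf [set c w | w in W])].
Proof.
move=> c W threshold; have /andP[s0 s_le] := hs.
have N1 : 0 < N%:R - 1 :> R by rewrite subr_gt0 ltr1n.
have N0 : 0 < N%:R :> R by rewrite ltr0n ltnW.
have k0 : 0 < 1 + N%:R * v by rewrite addr_gt0 ?mulr_gt0.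
have b0 : 0 < 1 + (N%:R - 1) * v by rewrite addr_gt0 ?mulr_gt0.
pose a : R := (N%:R - 1) / (2 * N%:R) * s ^+ 2.
pose m : R := (N%:R - 1) * (1 + N%:R * v).
pose K : R := Delta * sigma ^+ 2 * N%:R * q.
have m0 : 0 < m by rewrite mulr_gt0.
have K0 : 0 < K by rewrite !mulr_gt0 ?exprn_gt0.
have s2 : s ^+ 2 <= 2 * N%:R / (N%:R - 1).
  have M0 : 0 <= 2 * N%:R / (N%:R - 1) :> R by rewrite divr_ge0 ?mulr_ge0 ?ltW.
  by rewrite -(sqr_sqrtr M0) ler_sqr ?nnegrE ?sqrtr_ge0.
have a0 : 0 <= a by rewrite mulr_ge0 ?sqr_ge0 ?divr_ge0 ?mulr_ge0 ?ltW.
have a1 : a <= 1.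
  rewrite /a mulrC -ler_pdivlMr ?divr_gt0 ?mulr_gt0//.
  by rewrite invf_div mul1r.
have a01 : 0 <= a <= 1 by rewrite a0 a1.
have g0 x : 0 < x -> 0 < reduced_cost a m x by exact: reduced_cost_gt0.
have cE x : 0 < x < 1 ->
    c (weights_of N x) = Num.sqrt (K * reduced_cost a m x).
  exact: trading_cost_weights_of.
(* Since m + 1 = N(1+(N-1)v), the differences of the two sides of both inequalities agree up to
   positive factors. *)
have thresholdE : (s ^+ 2 < threshold) = (a < (1 - a) * m).
  rewrite ltr_pdivlMr// -subr_gt0 -[RHS]subr_gt0.
  have -> : (1 - a) * m - a = (N%:R - 1) / 2 *
      (2 * (1 + N%:R * v) - s ^+ 2 * (1 + (N%:R - 1) * v)).
    by rewrite /a /m; field; rewrite gt_eqF.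
  by rewrite pmulr_rgt0 ?divr_gt0.
split.
- move=> s_gt0; rewrite thresholdE => ap.
  have p0 : 0 < (1 - a) * m by exact: le_lt_trans ap.
  set D := (1 + N%:R * v) * (2 * N%:R - (N%:R - 1) * s ^+ 2).
  (* [D] is a positive multiple of p > a >= 0, so its square root is genuine and positive. *)
  have DE : D = 2 * N%:R * ((1 - a) * m) / (N%:R - 1).
    by rewrite /D /a /m; field; rewrite !gt_eqF.
  have D0 : 0 < D by rewrite DE divr_gt0// mulr_gt0// mulr_gt0.
  set r := s / Num.sqrt D.
  have r0 : 0 < r by rewrite divr_gt0 ?sqrtr_gt0.
  have r2 : r ^+ 2 = a / ((1 - a) * m).
    rewrite /r expr_div_n sqr_sqrtr ?ltW// DE.
    set p := (1 - a) * m in p0 *; rewrite /a.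
    by field; rewrite !gt_eqF.
  have r1 : r < 1.
    by rewrite -(@ltr_pXn2r _ 2) ?nnegrE ?ltW// expr1n r2 ltr_pdivrMr ?mul1r.
  exists (weights_of N r); rewrite !mxE eqxx; split=> //; last first.
    by move=> i i0; rewrite !mxE (negPf i0).
  apply: (unique_minimizer_weights_of hN K0 g0 cE); first by rewrite r0.
  by move=> x x0 xr; exact: reduced_cost_min.
- rewrite leNgt thresholdE -leNgt => pa.
  (* At a = 0 the inequality p <= a would read m <= 0. *)
  have a_neq0 : a != 0.
    apply/eqP => a_eq0; move: pa.
    by rewrite a_eq0 subr0 mul1r leNgt m0.
  have a_gt0 : 0 < a by rewrite lt_neqAle eq_sym a_neq0.
  split.
    apply: (no_minimizer hN K0 g0 cE) => x /andP[x0 x1].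
    (* Moving halfway towards 1 strictly lowers the cost. *)
    exists ((x + 1) / 2); first by apply/andP; split; lra.
    by apply: reduced_cost_decreasing => //; lra.
  apply: (cost_cvg_inf hN K0 cE (l := reduced_cost a m 1)).
  + near=> x; apply/andP; split; near: x; last exact: nbhs_left_lt.
    exact: nbhs_left_gt.
  + apply: cvg_at_left_filter; apply: reduced_cost_continuous.
    exact: oner_neq0.
  + by move=> x /andP[x0 x1]; apply/ltW/reduced_cost_decreasing.
(* Now a = 0, so the reduced cost is affine and increasing: halving x lowers it, and its limit at 0
   bounds it from below. *)
- move=> s_eq0; have gE x : reduced_cost a m x = m * x + 1.
    by rewrite /reduced_cost /a s_eq0; ring.
  split.
    apply: (no_minimizer hN K0 g0 cE) => x /andP[x0 x1].
    exists (x / 2); first by apply/andP; split; lra.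
    by rewrite !gE ltrD2r ltr_pM2l//; lra.
  apply: (cost_cvg_inf hN K0 cE (l := m * 0 + 1)).
  + near=> x; apply/andP; split; near: x; first exact: nbhs_right_gt.
    exact: nbhs_right_lt.
  + under eq_fun do rewrite gE; apply: cvg_at_right_filter.
    apply: cvgD; last exact: cvg_cst.
    by apply: cvgM; [exact: cvg_cst|exact: cvg_id].
  + by move=> x /andP[x0 x1]; rewrite gE lerD2r ler_pM2l// ltW.
Unshelve. all: by end_near. Qed.
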